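(* The Ewens distribution $p^\star$, $p^\star_N(\pi)=\frac{\prod_{B\in\pi}(b-1)!}{n!}$, is the unique random partition $p$ with the following properties: (i) $p$ generates the potential for TU games, i.e., $\mathrm{E}_p(v)=\mathrm{Pot}(v)$ for all $N\subseteq\mathbf{U}$ and all TU games $v$ on $N$; (ii) there exists a path independent restriction operator $r$ that preserves null games, satisfies $\mathrm{Pot}^r=\mathrm{E}_p$, and whose $r$-Shapley value $\mathrm{Sh}^r$ satisfies the null player property or monotonicity. Moreover, the restriction operator $r^\star$ given by $$w^{r^\star}_{-i}(S,\pi)=\frac{1}{n-s}w(S,\pi_{+i\leadsto\emptyset})+\sum_{B\in\pi}\frac{b}{n-s}w(S,\pi_{+i\leadsto B})$$ (for all $N\subseteq\mathbf{U}$, $w\in\mathbb{W}(N)$, $i\in N$, $(S,\pi)\in\mathcal{E}(N\setminus\{i\})$) is the unique such restriction operator, and it induces the MPW solution: $\mathrm{Sh}^{r^\star}=\mathrm{MPW}$.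
   Context: $\mathbf{U}$ is a finite set of players; cardinalities of sets $N,S,T,B$ are $n,s,t,b$. $\Pi(N)$ is the set of partitions of $N$ (with $\Pi(\emptyset)=\{\emptyset\}$). A random partition is a family $p=(p_N)_{N\subseteq\mathbf{U}}$ with $p_N$ a probability distribution on $\Pi(N)$. For $\pi\in\Pi(N\setminus\{i\})$ and $B\in\pi$, $\pi_{+i\leadsto B}=(\pi\setminus\{B\})\cup\{B\cup\{i\}\}$ and $\pi_{+i\leadsto\emptyset}=\pi\cup\{\{i\}\}$. A TU game on $N$ is $v:2^N\to\mathbb{R}$, $v(\emptyset)=0$; $v_{-i}$ is its restriction to $2^{N\setminus\{i\}}$. The Shapley value is $\mathrm{Sh}_i(v)=\sum_{S\subseteq N\setminus\{i\}}\frac{s!(n-s-1)!}{n!}(v(S\cup\{i\})-v(S))$. The potential for TU games is $\mathrm{Pot}(v)=\sum_{\emptyset\neq S\subseteq N}\frac{(s-1)!(n-s)!}{n!}v(S)$ (the unique map with $\mathrm{Pot}=0$ on the empty player set and $\sum_{i\in N}[\mathrm{Pot}(v)-\mathrm{Pot}(v_{-i})]=v(N)$). Embedded coalitions: $\mathcal{E}(N)=\{(S,\pi):S\subseteq N,\pi\in\Pi(N\setminus S)\}$. A TUX game on $N$ is $w:\mathcal{E}(N)\to\mathbb{R}$ with $w(\emptyset,\pi)=0$; $\mathbb{W}(N)$ is their set; a TU game $v$ is identified with the TUX game $w(S,\pi)=v(S)$; $\mathbf{0}^N$ is the null game. $\mathrm{E}_p(w)=\sum_{\pi\in\Pi(N)}p_N(\pi)\sum_{S\in\pi}w(S,\pi\setminus\{S\})$.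 A restriction operator $r$ assigns to each $N$, $w\in\mathbb{W}(N)$, $i\in N$ a game $w^r_{-i}\in\mathbb{W}(N\setminus\{i\})$ such that $w^r_{-i}(S,\pi)$ depends only on the values $w(S,\pi_{+i\leadsto B})$, $B\in\pi\cup\{\emptyset\}$. Path independent: $(w^r_{-i})^r_{-j}=(w^r_{-j})^r_{-i}$ for distinct $i,j$ (so $w^r_{-T}$ is well defined). Preserves null games: $(\mathbf{0}^N)^r_{-i}=\mathbf{0}^{N\setminus\{i\}}$. For path independent $r$: the auxiliary TU game is $v^r_w(S)=w^r_{-(N\setminus S)}(S,\emptyset)$, the $r$-potential is $\mathrm{Pot}^r(w)=\mathrm{Pot}(v^r_w)$ (the unique map with $\mathrm{Pot}^r(\mathbf{0}^\emptyset)=0$ and $\sum_{i\in N}[\mathrm{Pot}^r(w)-\mathrm{Pot}^r(w^r_{-i})]=w(N,\emptyset)$), and the $r$-Shapley value is $\mathrm{Sh}^r(w)=\mathrm{Sh}(v^r_w)$. The MPW solution is $\mathrm{MPW}(w)=\mathrm{Sh}(\bar v^\star_w)$ where $\bar v^\star_w(S)=\sum_{\pi\in\Pi(N\setminus S)}p^\star_{N\setminus S}(\pi)w(S,\pi)$. Player $i$ is a null player in $w\in\mathbb{W}(N)$ if $w(S\cup\{i\},\pi)=w(S,\pi_{+i\leadsto B})$ for all $(S,\pi)\in\mathcal{E}(N\setminus\{i\})$, $B\in\pi\cup\{\emptyset\}$. A solution $\varphi$ (assigning $\varphi(w)\in\mathbb{R}^N$ to each $w\in\mathbb{W}(N)$)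 satisfies the null player property if $\varphi_i(w)=0$ whenever $i$ is a null player in $w$; it satisfies monotonicity if, for $w,z\in\mathbb{W}(N)$ and $i\in N$ with $w(S\cup\{i\},\pi)-w(S,\pi_{+i\leadsto B})\ge z(S\cup\{i\},\pi)-z(S,\pi_{+i\leadsto B})$ for all $(S,\pi)\in\mathcal{E}(N\setminus\{i\})$, $B\in\pi\cup\{\emptyset\}$, one has $\varphi_i(w)\ge\varphi_i(z)$. *)

(* Defs.v *)
From mathcomp Require Import all_boot all_order all_algebra.
From mathcomp Require Import reals.
Set Implicit Arguments. Unset Strict Implicit. Unset Printing Implicit Defensive.
Import Order.TTheory GRing.Theory Num.Theory.
Local Open Scope ring_scope.

Section Games.
Variable R : realType.
Variable U : finType.

(* A TUX-game is represented as a total function on pairs (S, pi); only its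
   values on embedded coalitions of the player set N are meaningful. *)
Definition game := {set U} -> {set {set U}} -> R.
Definition tugame := {set U} -> R.
Definition restr_op := {set U} -> game -> U -> game.
Definition solution := {set U} -> game -> U -> R.
Definition rpart := {set U} -> {set {set U}} -> R.

(* pi is a partition of N (MathComp's [partition]: covers N, pairwise
   disjoint blocks, no empty block; partition set0 set0 holds) *)
Definition is_part (P : {set {set U}}) (N : {set U}) : bool := partition P N.

Definition emb (N S : {set U}) (P : {set {set U}}) : bool :=
  (S \subset N) && is_part P (N :\: S).

Definition tux (N : {set U}) (w : game) : Prop :=
  forall P, is_part P N -> w set0 P = 0.

Definition tu (v : tugame) : Prop := v set0 = 0.

Definition tu2tux (v : tugame) : game := fun S _ => v S.

Definition null_game : game := fun _ _ => 0.

Definition eqg (N : {set U}) (w z : game) : Prop :=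
  forall (S : {set U}) (P : {set {set U}}), emb N S P -> w S P = z S P.

(* pi_{+i ~> B}; B = set0 means pi_{+i ~> emptyset} *)
Definition addto (P : {set {set U}}) (i : U) (B : {set U}) : {set {set U}} :=
  if B == set0 then [set i] |: P else (B :|: [set i]) |: (P :\ B).

Definition random_partition (p : rpart) : Prop :=
  [/\ forall (N : {set U}) (P : {set {set U}}), 0 <= p N P,
      forall (N : {set U}) (P : {set {set U}}), ~~ is_part P N -> p N P = 0 &
      forall (N : {set U}), \sum_(P : {set {set U}} | is_part P N) p N P = 1].

Definition ewens : rpart := fun (N : {set U}) (P : {set {set U}}) =>
  if is_part P N then (\prod_(B in P) (#|B|.-1)`!)%:R / (#|N|`!)%:R else 0.

Definition expect (p : rpart) (N : {set U}) (w : game) : R :=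
  \sum_(P : {set {set U}} | is_part P N) p N P * \sum_(S in P) w S (P :\ S).

Definition pot (N : {set U}) (v : tugame) : R :=
  \sum_(S : {set U} | (S \subset N) && (S != set0))
     ((#|S|.-1)`! * (#|N| - #|S|)`!)%:R / (#|N|`!)%:R * v S.

Definition sh (N : {set U}) (v : tugame) (i : U) : R :=
  \sum_(S : {set U} | S \subset N :\ i)
     ((#|S|)`! * (#|N| - #|S| - 1)`!)%:R / (#|N|`!)%:R * (v (i |: S) - v S).

Definition restriction_op (r : restr_op) : Prop :=
  (forall (N : {set U}) (w : game) (i : U), i \in N -> tux N w -> tux (N :\ i) (r N w i)) /\
  (forall (N : {set U}) (w z : game) (i : U), i \in N -> tux N w -> tux N z ->
     forall (S : {set U}) (P : {set {set U}}), emb (N :\ i) S P ->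
     (forall B : {set U}, (B \in P) || (B == set0) -> w S (addto P i B) = z S (addto P i B)) ->
     r N w i S P = r N z i S P).

Definition path_indep (r : restr_op) : Prop :=
  forall (N : {set U}) (w : game) (i j : U), i \in N -> j \in N -> i != j -> tux N w ->
    eqg (N :\ i :\ j) (r (N :\ i) (r N w i) j) (r (N :\ j) (r N w j) i).

Definition preserves_null (r : restr_op) : Prop :=
  forall (N : {set U}) (i : U), i \in N -> eqg (N :\ i) (r N null_game i) null_game.

Fixpoint restr_seq (r : restr_op) (N : {set U}) (w : game) (s : seq U) : game :=
  if s is t :: s' then restr_seq r (N :\ t) (r N w t) s' else w.

Definition vr (r : restr_op) (N : {set U}) (w : game) : tugame :=
  fun S : {set U} => restr_seq r N w (enum (N :\: S)) S set0.

Definition potr (r : restr_op) (N : {set U}) (w : game) : R := pot N (vr r N w).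

Definition shr (r : restr_op) : solution := fun (N : {set U}) (w : game) (i : U) => sh N (vr r N w) i.

Definition null_player (N : {set U}) (w : game) (i : U) : Prop :=
  forall (S : {set U}) (P : {set {set U}}), emb (N :\ i) S P ->
  forall B : {set U}, (B \in P) || (B == set0) -> w (i |: S) P = w S (addto P i B).

Definition null_player_property (phi : solution) : Prop :=
  forall (N : {set U}) (w : game) (i : U), i \in N -> tux N w -> null_player N w i -> phi N w i = 0.

Definition monotonicity (phi : solution) : Prop :=
  forall (N : {set U}) (w z : game) (i : U), i \in N -> tux N w -> tux N z ->
  (forall (S : {set U}) (P : {set {set U}}), emb (N :\ i) S P -> forall B : {set U}, (B \in P) || (B == set0) ->
     z (i |: S) P - z S (addto P i B) <= w (i |: S) P - w S (addto P i B)) ->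
  phi N z i <= phi N w i.

Definition generates_potential (p : rpart) : Prop :=
  forall (N : {set U}) (v : tugame), tu v -> expect p N (tu2tux v) = pot N v.

Definition good_op (p : rpart) (r : restr_op) : Prop :=
  [/\ restriction_op r, path_indep r, preserves_null r,
      (forall (N : {set U}) (w : game), tux N w -> potr r N w = expect p N w) &
      (null_player_property (shr r) \/ monotonicity (shr r))].

Definition rstar : restr_op := fun (N : {set U}) (w : game) (i : U) (S : {set U}) (P : {set {set U}}) =>
  (#|N| - #|S|)%:R^-1 * w S (addto P i set0)
  + \sum_(B in P) (#|B|%:R / (#|N| - #|S|)%:R) * w S (addto P i B).

Definition mpw : solution := fun (N : {set U}) (w : game) (i : U) =>
  sh N (fun S : {set U} => \sum_(P : {set {set U}} | is_part P (N :\: S)) ewens (N :\: S) P * w S P) i.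

End Games.
Arguments ewens {R U}.
Arguments rstar {R U}.

(* Main.v *)
(* Write pi - i for the partition obtained from pi by removing player i. The
   map B |-> pi_{+i ~> B} is a bijection from pi plus the empty set onto the
   partitions Q with Q - i = pi, and the Ewens distribution satisfies
   p*(pi_{+i ~> B}) = (max(b, 1) / n) p*(pi). Hence r* averages w over
   {Q : Q - i = pi} with weights p*(Q) / p*(pi). Iterating, r* is path
   independent and its auxiliary game is the p*-average of w, which yields the
   MPW solution and its null player property.

   Conversely let (p, r) satisfy (ii). Comparing the two expressions of the
   r-potential on games supported on one coalition S gives v^r_w(S) as an
   explicit combination of the values p(S |: Q) w(S, Q). The game in which
   exactly (T + i, pi) and all (T, pi_{+i ~> B}) are worth 1 has the null player
   i, which forces p(pi_{+i ~> B}) to be proportional to max(b, 1) in B: the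
   ratio p / p* at Q depends only on Q - i. Splitting off players one at a time,
   it is constant, so p = p*. Finally v^r_w(S) is unchanged by removing i outside
   S; applied to games supported on {(S, Q) : Q - i = pi}, this determines r. *)
Require Import Defs.
From mathcomp Require Import all_boot all_order all_algebra.
From mathcomp Require Import reals ring.
Set Implicit Arguments.
Unset Strict Implicit.
Unset Printing Implicit Defensive.
Import Order.TTheory GRing.Theory Num.Theory.
Local Open Scope ring_scope.

(** * Removing a player from a partition and adding one back *)

Section Partitions.
Variable U : finType.
Implicit Types (N S B : {set U}) (P Q : {set {set U}}) (i j : U).

(** A singleton block of [i] turns into [set0], which must then be discarded. *)
Definition rmv P i : {set {set U}} := [set B :\ i | B in P] :\ set0.

Lemma set1U_neq0 i B : i |: B != set0.
Proof. by apply/set0Pn; exists i; rewrite setU11. Qed.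

Lemma part_notin N P B i : partition P N -> i \in B -> i \notin N -> B \notin P.
Proof.
by move=> partP iB; apply: contra => BP; apply: (subsetP (partitionS partP BP)).
Qed.

Lemma partition_block_notin N P S : S != set0 -> partition P (N :\: S) -> S \notin P.
Proof.
case/set0Pn=> x xS partP; apply: (part_notin partP xS).
by rewrite inE xS.
Qed.

Lemma partition_setU1 N P S : S \subset N -> S != set0 ->
  partition P (N :\: S) -> partition (S |: P) N.
Proof.
move=> sSN S0 partP; have dSN : [disjoint S & N :\: S].
  by rewrite disjoints_subset setDE setCI setCK subsetUr.
have := partitionU1 partP S0 dSN.
by rewrite setDE setUIr setUCr setIT (setUidPr sSN).
Qed.

Lemma rmv_id N P i : partition P N -> i \notin N -> rmv P i = P.
Proof.
move=> partP iN; rewrite /rmv.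
have -> : [set B :\ i | B in P] = P.
  rewrite -[RHS]imset_id; apply: eq_in_imset => B BP; apply/setP=> x.
  rewrite !inE; case: eqVneq => //= ->; apply/esym/negbTE.
  by apply: contra iN; apply: (subsetP (partitionS partP BP)).
by apply/setP=> B; rewrite !inE; case: eqVneq => //= ->; rewrite (partition0 partP).
Qed.

Lemma rmv_setU1 P B i : i \in B -> rmv (B |: P) i = (B :\ i |: rmv P i) :\ set0.
Proof.
move=> iB; rewrite /rmv imsetU1; apply/setP=> C; rewrite !inE.
by case: (C == set0); rewrite ?orbF.
Qed.

Lemma setDDC N S B : N :\: S :\: B = N :\: B :\: S.
Proof. by apply/setP=> x; rewrite !inE andbCA. Qed.

(** Case analysis on the block of [i], written [i |: B]. Since [B] may be empty, a singleton block
    is no separate case. *)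
Variant part_split N i : {set {set U}} -> Prop :=
  PartSplit B Q of i \notin B & B \subset N & i \in N & partition Q (N :\ i :\: B)
     : part_split N i (i |: B |: Q).

Lemma part_splitP N P i : i \in N -> partition P N -> part_split N i P.
Proof.
move=> iN partP; have iP : i \in cover P by rewrite (cover_partition partP).
set C := pblock P i; have CP : C \in P by rewrite pblock_mem.
have iC : i \in C by rewrite mem_pblock.
move: (partitionD1 partP CP) (setD1K CP).
move: (P :\ C) => Q partQ <-; rewrite -(setD1K iC); apply: PartSplit => //; first by rewrite setD11.
  by apply: subset_trans (subsetDl _ _) (partitionS partP CP).
have -> : N :\ i :\: (C :\ i) = N :\: C.
  by apply/setP=> x; rewrite !inE; case: eqVneq => //= ->; rewrite iC.
exact: partQ.
Qed.

Lemma partition_split N i B Q : i \notin B -> B \subset N -> i \in N ->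
  partition Q (N :\ i :\: B) -> partition (i |: B |: Q) N.
Proof.
move=> iB sBN iN partQ; apply: partition_setU1; rewrite ?set1U_neq0 //.
  by rewrite subUset sub1set iN.
by rewrite setDDl in partQ.
Qed.

Lemma rmv_split N i B Q : i \notin B -> B \subset N -> i \in N ->
  partition Q (N :\ i :\: B) ->
  rmv (i |: B |: Q) i = if B == set0 then Q else B |: Q.
Proof.
move=> iB sBN iN partQ; rewrite rmv_setU1 ?setU11 // setU1K //.
rewrite (rmv_id partQ); last by rewrite !inE eqxx andbF.
have Q0 := partition0 partQ.
case: eqVneq => [->|B0]; apply/setP=> C; rewrite !inE; case: eqVneq => //= ->.
  by rewrite Q0.
by rewrite Q0 orbF eq_sym (negbTE B0).
Qed.

Lemma partition_rmv N P i : i \in N -> partition P N -> partition (rmv P i) (N :\ i).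
Proof.
move=> iN /(part_splitP iN)[B Q iB sBN _ partQ]; rewrite (rmv_split iB sBN iN partQ).
case: eqVneq => [B0|B0]; first by rewrite B0 setD0 in partQ.
by apply: partition_setU1 => //; rewrite subsetD1 sBN.
Qed.

(** A new block is written [i |: set0], so that both ways of adding [i] fit the facts about
    [i |: B |: Q]. *)
Variant addto_spec N P i : {set U} -> {set {set U}} -> Prop :=
  | AddtoNew of partition P (N :\ i) : addto_spec N P i set0 (i |: set0 |: P)
  | AddtoOld B Q of P = B |: Q & B != set0 & i \notin B & B \subset N & B \notin Q
     & partition Q (N :\ i :\: B) : addto_spec N P i B (i |: B |: Q).

Lemma addtoP N P i B : i \in N -> partition P (N :\ i) -> B \in set0 |: P ->
  addto_spec N P i B (addto P i B).
Proof.
move=> iN partP; rewrite !inE /addto; case: eqVneq => [-> _|B0 /= BP].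
  by rewrite -[[set i]]setU0; apply: AddtoNew.
have := partitionS partP BP; rewrite subsetD1 => /andP[sBN iB].
rewrite [B :|: _]setUC; apply: AddtoOld; rewrite ?setD1K ?setD11 //.
exact: partitionD1.
Qed.

Lemma partition_addto N P i B : i \in N -> partition P (N :\ i) ->
  B \in set0 |: P -> partition (addto P i B) N.
Proof.
move=> iN partP BP; case: (addtoP iN partP BP) => [_|{BP}B Q ? ? iB sBN _ partQ].
  by apply: partition_split; rewrite ?inE ?sub0set // setD0.
exact: partition_split.
Qed.

Lemma addtoK N P i B : i \in N -> partition P (N :\ i) ->
  B \in set0 |: P -> rmv (addto P i B) i = P.
Proof.
move=> iN partP BP; case: (addtoP iN partP BP) => [_|{BP}B Q -> B0 iB sBN _ partQ].
  by rewrite (@rmv_split N) ?inE ?sub0set ?eqxx // setD0.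
by rewrite (@rmv_split N) // (negbTE B0).
Qed.

Lemma addto_pblock N P i B : i \in N -> partition P (N :\ i) ->
  B \in set0 |: P -> pblock (addto P i B) i = i |: B.
Proof.
move=> iN partP BP; have := partition_addto iN partP BP.
by case: (addtoP iN partP BP) => [_|{BP}B Q ? B0 iB sBN _ partQ] /partition_trivIset tP;
  apply: (def_pblock tP); rewrite ?setU11.
Qed.

Lemma block_notin_addto N P i B : i \in N -> partition P (N :\ i) ->
  B \in set0 |: P -> i \notin B.
Proof.
by move=> iN partP BP; case: (addtoP iN partP BP); rewrite ?inE.
Qed.

Lemma rmvK N P i : i \in N -> partition P N -> 
  (pblock P i :\ i \in set0 |: rmv P i) && (addto (rmv P i) i (pblock P i :\ i) == P).
Proof.
move=> iN partP; have tP := partition_trivIset partP.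
move: tP (partition_rmv iN partP); case/(part_splitP iN): partP => B Q iB sBN _ partQ tP.
rewrite (def_pblock tP (setU11 _ _)) ?setU11 // (rmv_split iB sBN iN partQ) setU1K //.
rewrite /addto !inE; case: eqVneq => [->|B0] partP; first by rewrite setU0 eqxx.
rewrite !inE eqxx orbT [B :|: _]setUC setU1K ?eqxx //.
by apply: (partition_block_notin B0 partQ).
Qed.

Lemma rmvC P i j : rmv (rmv P i) j = rmv (rmv P j) i.
Proof.
(* An empty block arising from the first removal stays empty, so discarding [set0] once at the end
   suffices. *)
have E k l : rmv (rmv P k) l = [set B :\ k :\ l | B in P] :\ set0.
  apply/setP=> C; rewrite !inE; case: (eqVneq C set0) => //= C0.
  apply/imsetP/imsetP=> [[D]|[D DP CE]].
    by rewrite !inE => /andP[_ /imsetP[E EP ->]] ->; exists E.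
  exists (D :\ k) => //; rewrite in_setD1 (imset_f (fun B => B :\ k) DP) andbT.
  by apply: contra C0 => /eqP D0; rewrite CE D0 set0D.
rewrite !E; congr (_ :\ _); apply: eq_imset => B.
exact: setDDC.
Qed.

(** * Reindexing sums over partitions *)

Section Sums.
Variables (V : nmodType).

(** [addto P i] is a bijection onto the fibre of [rmv] over [P]; its inverse sends [Q] to the block
    of [i] in [Q], without [i]. *)
Lemma sum_addto (F : {set {set U}} -> V) N P i : i \in N -> partition P (N :\ i) ->
  \sum_(B in set0 |: P) F (addto P i B) =
  \sum_(Q | partition Q N && (rmv Q i == P)) F Q.
Proof.
move=> iN partP; rewrite [RHS](reindex_onto (addto P i) (fun Q => pblock Q i :\ i)) /=.
  apply: eq_big => // B; apply/idP/andP=> [BP|[/andP[partA /eqP rA] /eqP <-]].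
    rewrite (partition_addto iN partP BP) (addtoK iN partP BP) (addto_pblock iN partP BP).
    by rewrite setU1K ?eqxx // (block_notin_addto iN partP BP).
  by case/andP: (rmvK iN partA); rewrite rA.
move=> Q /andP[partQ /eqP rQ].
by case/andP: (rmvK iN partQ); rewrite rQ => _ /eqP.
Qed.

Lemma sum_part_addto (F : {set {set U}} -> V) N i : i \in N ->
  \sum_(Q | partition Q N) F Q =
  \sum_(P | partition P (N :\ i)) \sum_(B in set0 |: P) F (addto P i B).
Proof.
move=> iN.
rewrite (partition_big (rmv^~ i) (partition^~ (N :\ i))) => [|Q]; last exact: partition_rmv.
by apply: eq_bigr => P partP; rewrite (sum_addto _ iN partP).
Qed.

(** A partition with a marked block [S] amounts to a nonempty [S] and a partition of the rest. This
    turns expectations into sums over coalitions. *)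
Lemma sum_part_block (F : {set U} -> {set {set U}} -> V) N :
  \sum_(P | partition P N) \sum_(S in P) F S P =
  \sum_(S : {set U} | (S \subset N) && (S != set0))
     \sum_(Q | partition Q (N :\: S)) F S (S |: Q).
Proof.
rewrite (exchange_big_dep (fun S => (S \subset N) && (S != set0))) /=; last first.
  by move=> P S partP SP; rewrite (partitionS partP SP) (partition_neq0 partP SP).
apply: eq_bigr => S /andP[sSN S0].
rewrite (reindex_onto (fun Q => S |: Q) (fun P => P :\ S)) /=; last first.
  by move=> P /andP[_ SP]; rewrite setD1K.
apply: eq_bigl => Q; apply/andP/idP=> [[/andP[partP SP] /eqP <-]|partQ].
  exact: partitionD1.
by rewrite partition_setU1 // setU11 setU1K // (partition_block_notin S0 partQ).
Qed.

End Sums.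
End Partitions.

(** * The Ewens distribution *)

Section Ewens.
Variables (R : realType) (U : finType).
Implicit Types (N S B T : {set U}) (P Q : {set {set U}}) (i j : U) (w z : game R U).

Lemma factR_neq0 n : n`!%:R != 0 :> R.
Proof. by rewrite pnatr_eq0 -lt0n fact_gt0. Qed.

Lemma ewens_gt0 N P : partition P N -> 0 < ewens N P :> R.
Proof.
move=> partP; rewrite /ewens /is_part partP divr_gt0 // ltr0n ?fact_gt0 //.
by apply: prodn_gt0 => B; rewrite fact_gt0.
Qed.

Lemma ewens_neq0 N P : partition P N -> ewens N P != 0 :> R.
Proof. by move=> /ewens_gt0 /lt0r_neq0. Qed.

Lemma ewens_set0 : ewens (set0 : {set U}) set0 = 1 :> R.
Proof. by rewrite /ewens /is_part partition_set0 eqxx big_set0 cards0 fact0 divr1. Qed.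

(** The factor is the coefficient of [S] in [pot], which is why the Ewens distribution generates the
    potential. *)
Lemma ewens_setU1 N S P : S \subset N -> S != set0 -> partition P (N :\: S) ->
  ewens N (S |: P) =
    ((#|S|.-1)`! * (#|N| - #|S|)`!)%:R / (#|N|`!)%:R * ewens (N :\: S) P :> R.
Proof.
move=> sSN S0 partP; rewrite /ewens /is_part partP partition_setU1 //.
rewrite big_setU1 ?(partition_block_notin S0 partP) //= cardsDS // !natrM.
by field; rewrite !factR_neq0.
Qed.

(* The relative probability of joining block B; the empty set stands for a new block. *)
Definition weight B : nat := maxn 1 #|B|.

(** The blocks of [P] contain all players but [i], and the new block adds 1. Hence the weights over
    [#|N|] are probabilities, those of the Chinese restaurant process. *)
Lemma sum_weight N P i : i \in N -> partition P (N :\ i) ->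
  (\sum_(B in set0 |: P) weight B = #|N|)%N.
Proof.
move=> iN partP; rewrite big_setU1 ?(partition0 partP) //= /weight cards0 maxn0.
rewrite (cardsD1 i N) iN (card_partition partP); congr addn.
apply: eq_bigr => B BP; apply/maxn_idPr.
by rewrite card_gt0 (partition_neq0 partP BP).
Qed.

(** Peel off the block of [i] on the left and, if [B] is not empty, [B] itself on the right; the
    remaining partitions coincide and only factorials are left to compare. *)
Lemma ewens_addto N P i B : i \in N -> partition P (N :\ i) -> B \in set0 |: P ->
  ewens N (addto P i B) = (weight B)%:R / #|N|%:R * ewens (N :\ i) P :> R.
Proof.
move=> iN partP BP; have N0 : #|N|%:R != 0 :> R.
  by rewrite pnatr_eq0 (cardsD1 i) iN.
case: (addtoP iN partP BP) => [_|{BP}B Q PE B0 iB sBN BQ partQ].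
  rewrite ewens_setU1 ?set1U_neq0 ?setU0 ?sub1set // /weight cards0 cards1 mul1n maxn0.
  congr (_ * _); move: N0; rewrite (cardsD1 i N) iN add1n subn1 factS natrM /= => N0.
  by field; rewrite nat1r N0 factR_neq0.
have siBN : i |: B \subset N by rewrite subUset sub1set iN.
rewrite ewens_setU1 ?set1U_neq0 // -?setDDl // PE ewens_setU1 // ?subsetD1 ?sBN //.
have leB : (#|B| <= #|N :\ i|)%N by rewrite subset_leq_card // subsetD1 sBN.
rewrite cardsU1 iB add1n /= /weight.
have B1 : (0 < #|B|)%N by rewrite card_gt0.
rewrite (maxn_idPr B1) mulrA; congr (_ * _).
move: N0; rewrite (cardsD1 i N) iN add1n subSS factS.
case: #|B| B1 => // b _ N0; rewrite factS /= !natrM.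
by field; rewrite nat1r N0 factR_neq0.
Qed.

(** Induction on the number of players: by [sum_weight], each fibre of [rmv] over [P] has the mass
    of [P]. *)
Lemma sum_ewens N : \sum_(P | partition P N) ewens N P = 1 :> R.
Proof.
have [n] := ubnP #|N|; elim: n N => // n IHn N.
case: (set_0Vmem N) => [-> _|[i iN]].
  rewrite (big_pred1 set0) ?ewens_set0 // => P; exact: partition_set0.
rewrite (cardsD1 i) iN ltnS => /IHn E.
rewrite (sum_part_addto _ iN) -[RHS]E; apply: eq_bigr => P partP.
rewrite (eq_bigr _ (fun B => @ewens_addto N P i B iN partP)) -mulr_suml -mulr_suml.
rewrite -natr_sum (sum_weight iN partP) divff ?mul1r //.
by rewrite pnatr_eq0 (cardsD1 i) iN.
Qed.

Lemma ewens_random_partition : random_partition (@ewens R U).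
Proof.
split=> [N P|N P /negbTE|N]; rewrite ?sum_ewens // /ewens; last by move=> ->.
by case: ifP => // _; rewrite divr_ge0.
Qed.

(** The averaged TU game whose Shapley value is the MPW solution. *)
Definition mean N w S : R := \sum_(P | partition P (N :\: S)) ewens (N :\: S) P * w S P.

Lemma expect_ewens N w : expect ewens N w = pot N (mean N w).
Proof.
rewrite /expect /pot; under eq_bigr do rewrite mulr_sumr.
rewrite (@sum_part_block _ _ (fun S P => ewens N P * w S (P :\ S))).
apply: eq_bigr => S /andP[sSN S0]; rewrite /mean mulr_sumr; apply: eq_bigr => P partP.
by rewrite setU1K ?(partition_block_notin S0 partP) // ewens_setU1 // mulrA.
Qed.

Lemma ewens_generates_potential : generates_potential (@ewens R U).
Proof.
move=> N v _; rewrite expect_ewens; apply: eq_bigr => S _.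
by rewrite /mean /tu2tux -mulr_suml sum_ewens mul1r.
Qed.

(** * The operator [rstar] and its auxiliary game *)

Lemma rstarE N w i S P : i \in N :\: S -> S \subset N -> partition P ((N :\: S) :\ i) ->
  rstar N w i S P =
  \sum_(B in set0 |: P) (weight B)%:R / #|N :\: S|%:R * w S (addto P i B).
Proof.
move=> iN sSN partP; rewrite big_setU1 ?(partition0 partP) //= cardsDS // /rstar.
rewrite /weight cards0 maxn0 mul1r; congr (_ + _); apply: eq_bigr => B BP.
by rewrite (maxn_idPr _) // card_gt0 (partition_neq0 partP BP).
Qed.

(** By [ewens_addto], [rstar] is a conditional expectation: it averages [w S Q] over the Ewens
    distribution given [rmv Q i = P]. *)
Lemma ewens_rstar N w i S P : i \in N :\: S -> S \subset N ->
    partition P ((N :\: S) :\ i) ->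
  ewens (N :\: S :\ i) P * rstar N w i S P =
  \sum_(Q | partition Q (N :\: S) && (rmv Q i == P)) ewens (N :\: S) Q * w S Q.
Proof.
move=> iN sSN partP; rewrite rstarE // -(sum_addto _ iN partP) mulr_sumr.
by apply: eq_bigr => B BP; rewrite ewens_addto // mulrCA mulrA.
Qed.

(** Tower property: iterated conditional expectations give the full mean, for any order of
    removal. *)
Lemma restr_seq_rstar (s : seq U) N w S : uniq s -> s =i N :\: S -> S \subset N ->
  restr_seq rstar N w s S set0 = mean N w S.
Proof.
elim: s N w => [|a s IHs] N w /=; rewrite /mean.
  move=> _ E sSN; have -> : N :\: S = set0 by apply/setP=> x; rewrite -E inE.
  by rewrite (big_pred1 set0) ?ewens_set0 ?mul1r // => P; exact: partition_set0.
move=> /andP[a_s us] E sSN; have aNS : a \in N :\: S by rewrite -E mem_head.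
have /andP[aS aN] : (a \notin S) && (a \in N) by rewrite inE in aNS.
rewrite IHs //; last by rewrite subsetD1 sSN.
  rewrite /mean setDDC.
  rewrite [RHS](partition_big (fun Q => rmv Q a) (fun P => partition P (N :\: S :\ a))) /=.
    by apply: eq_bigr => P partP; rewrite ewens_rstar.
  by move=> Q; exact: partition_rmv.
move=> x; rewrite setDDC in_setD1 -E inE; case: eqVneq => //= ->.
exact/negbTE.
Qed.

Lemma vr_rstar N w S : S \subset N -> vr rstar N w S = mean N w S.
Proof.
by move=> sSN; apply: restr_seq_rstar => //; [exact: enum_uniq | exact: mem_enum].
Qed.

Lemma emb_setD1 N S P i : i \in N ->
  emb (N :\ i) S P = [&& i \in N :\: S, S \subset N & partition P (N :\: S :\ i)].
Proof. by move=> iN; rewrite /emb /is_part subsetD1 setDDC inE iN andbT andbCA andbA. Qed.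

Lemma rstar_restriction_op : restriction_op (@rstar R U).
Proof.
split=> [N w i iN tw P partP|N w z i iN tw tz S P].
  rewrite rstarE ?setD0 ?sub0set // big1 // => B BP.
  by rewrite tw ?mulr0 //; apply: partition_addto BP.
rewrite emb_setD1 // => /and3P[iNS sSN partP] E; rewrite !rstarE //.
by apply: eq_bigr => B; rewrite !inE orbC => /E ->.
Qed.

(** Restricting twice conditions on the partition without [i] and [j]. By [rmvC] this is symmetric
    in the two players, whence path independence. *)
Lemma rstar2E N w i j S P : i \in N -> j \in N -> i != j -> emb (N :\ i :\ j) S P ->
  ewens (N :\: S :\ i :\ j) P * rstar (N :\ i) (rstar N w i) j S P =
  \sum_(Q | partition Q (N :\: S) && (rmv (rmv Q i) j == P)) ewens (N :\: S) Q * w S Q.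
Proof.
move=> iN jN ij; rewrite emb_setD1 ?in_setD1 1?eq_sym ?ij // => /and3P[jNS].
rewrite subsetD1 => /andP[sSN iS]; rewrite setDDC in jNS *.
have iNS : i \in N :\: S by rewrite inE iS.
move=> partP; have := @ewens_rstar (N :\ i) (rstar N w i) j S P.
rewrite setDDC subsetD1 sSN => -> //.
rewrite [RHS](partition_big (fun Q => rmv Q i)
   (fun Q => partition Q (N :\: S :\ i) && (rmv Q j == P))) /=; last first.
  by move=> Q /andP[partQ ->]; rewrite partition_rmv.
apply: eq_bigr => Q /andP[partQ /eqP rQ]; rewrite ewens_rstar //.
by apply: eq_bigl => Q'; case: (eqVneq (rmv Q' i) Q) => [->|_]; rewrite ?andbF // rQ eqxx !andbT.
Qed.

Lemma rstar_path_indep : path_indep (@rstar R U).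
Proof.
move=> N w i j iN jN ij tw S P embP.
have /andP[_ /ewens_neq0 e0] := embP.
apply: (mulfI e0); rewrite !(setDDC _ _ S) rstar2E // setDDC rstar2E 1?eq_sym //.
  by apply: eq_bigl => Q; rewrite rmvC.
by rewrite setDDC.
Qed.

Lemma rstar_preserves_null : preserves_null (@rstar R U).
Proof.
move=> N i iN S P; rewrite emb_setD1 // => /and3P[iNS sSN partP]; rewrite rstarE //.
by rewrite big1 // => B _; rewrite mulr0.
Qed.

(** Spread the mass of each [P] over its fibre; nullness of [i] equates [w (i |: S) P] with the
    value of [w S] at every point of that fibre. *)
Lemma mean_null_player N w i S : i \in N -> null_player N w i -> S \subset N :\ i ->
  mean N w (i |: S) = mean N w S.
Proof.
move=> iN nw; rewrite subsetD1 => /andP[sSN iS].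
have iNS : i \in N :\: S by rewrite inE iS.
rewrite /mean setUC -setDDl [RHS](sum_part_addto _ iNS); apply: eq_bigr => P partP.
transitivity (\sum_(B in set0 |: P) ewens (N :\: S) (addto P i B) * w (i |: S) P).
  rewrite (eq_bigr (fun B => (weight B)%:R / #|N :\: S|%:R *
                               (ewens (N :\: S :\ i) P * w (i |: S) P))).
    rewrite -mulr_suml -mulr_suml -natr_sum (sum_weight iNS partP) divff ?mul1r 1?setUC //.
    by rewrite pnatr_eq0 (cardsD1 i) iNS.
  by move=> B BP; rewrite ewens_addto // mulrA.
apply: eq_bigr => B BP; congr (_ * _); apply: nw.
  by rewrite emb_setD1 // iNS sSN.
by rewrite orbC -in_setU1.
Qed.

Lemma shr_rstar N w i : i \in N -> shr rstar N w i = mpw N w i.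
Proof.
move=> iN; rewrite /shr /mpw /sh; apply: eq_bigr => S.
by rewrite subsetD1 => /andP[sSN iS]; rewrite !vr_rstar // subUset sub1set iN.
Qed.

Lemma rstar_null_player_property : null_player_property (shr (@rstar R U)).
Proof.
move=> N w i iN tw nw; rewrite shr_rstar //; apply: big1 => S sSN.
by rewrite -[X in X - _]/(mean N w (i |: S)) mean_null_player // subrr mulr0.
Qed.

Lemma rstar_good : good_op ewens (@rstar R U).
Proof.
split; [exact: rstar_restriction_op | exact: rstar_path_indep
  | exact: rstar_preserves_null | | by left; exact: rstar_null_player_property].
move=> N w tw; rewrite expect_ewens; apply: eq_bigr => S /andP[sSN _].
by rewrite vr_rstar.
Qed.

End Ewens.

(** * Arbitrary restriction operators and their auxiliary games *)

Section Uniqueness.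
Variables (R : realType) (U : finType).
Implicit Types (N S B T : {set U}) (P Q : {set {set U}}) (i j : U) (w z : game R U).

Definition agree N S w z := forall P, partition P (N :\: S) -> w S P = z S P.

(** Isolates one coalition, so that a single term of the potential survives; [D] can restrict it
    further to one fibre of [rmv]. *)
Definition localize S (D : pred {set {set U}}) w : game R U :=
  fun T P => if (T == S) && D P then w T P else 0.

Lemma tux_null N : tux N (@null_game R U). Proof. by []. Qed.

Lemma tux_localize N S D w : tux N w -> tux N (localize S D w).
Proof. by move=> tw P partP; rewrite /localize; case: ifP => // _; apply: tw. Qed.

Section RestrictionOperator.
Variable r : restr_op R U.
Hypothesis r_op : restriction_op r.

Lemma tux_restr N w i : i \in N -> tux N w -> tux (N :\ i) (r N w i).
Proof. exact: r_op.1. Qed.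

Lemma restr_local N w z i S P : i \in N -> tux N w -> tux N z -> emb (N :\ i) S P ->
  (forall Q, partition Q (N :\: S) -> rmv Q i = P -> w S Q = z S Q) ->
  r N w i S P = r N z i S P.
Proof.
move=> iN tw tz embP E; apply: r_op.2 => // B; rewrite orbC -in_setU1 => BP.
move: embP; rewrite emb_setD1 // => /and3P[iNS _ partP].
by apply: E; [exact: partition_addto iNS partP BP | exact: addtoK iNS partP BP].
Qed.

Lemma agree_restr N S w z i : i \in N -> S \subset N :\ i -> tux N w -> tux N z ->
  agree N S w z -> agree (N :\ i) S (r N w i) (r N z i).
Proof.
move=> iN sSN tw tz E P partP; apply: restr_local => //; first by rewrite /emb sSN.
by move=> Q /E.
Qed.

Lemma enumerates_behead a (s : seq U) N S : S \subset N -> uniq (a :: s) -> a :: s =i N :\: S ->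
  [/\ a \in N, S \subset N :\ a, uniq s & s =i N :\ a :\: S].
Proof.
move=> sSN /= /andP[a_s us] E; have := E a; rewrite mem_head inE => /esym/andP[aS aN].
rewrite subsetD1 sSN; split=> // x; rewrite setDDC in_setD1 -E inE.
by case: eqVneq => //= ->; apply/negbTE.
Qed.

(** Restriction never changes the coalition at which a game is read, so agreement at [S] propagates
    along the sequence. *)
Lemma agree_restr_seq (s : seq U) N S w z : S \subset N -> uniq s -> s =i N :\: S ->
  tux N w -> tux N z -> agree N S w z -> restr_seq r N w s S set0 = restr_seq r N z s S set0.
Proof.
elim: s N w z => [|a s IHs] N w z sSN us E tw tz wz /=.
  by apply: wz; have -> : N :\: S = set0 by [apply/setP=> x; rewrite -E inE];
    rewrite partition_set0.
have [aN sSa us' E'] := enumerates_behead sSN us E.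
by apply: IHs => //; [exact: tux_restr | exact: tux_restr | exact: agree_restr].
Qed.

Lemma vr_agree N S w z : S \subset N -> tux N w -> tux N z -> agree N S w z ->
  vr r N w S = vr r N z S.
Proof.
by move=> *; apply: agree_restr_seq => //; [exact: enum_uniq | exact: mem_enum].
Qed.

(** Path independence swaps [i] with the head of the sequence, which by induction brings [i] to the
    front. *)
Lemma restr_seq_rem (s : seq U) N S w i : path_indep r -> S \subset N ->
  uniq s -> s =i N :\: S -> tux N w -> i \in s ->
  restr_seq r N w s S set0 = restr_seq r (N :\ i) (r N w i) (rem i s) S set0.
Proof.
move=> r_pi; elim: s N w => // a s IHs N w sSN us E tw; rewrite inE /= [a == i]eq_sym.
have [aN sSa us' E'] := enumerates_behead sSN us E.
case: eqVneq => [->|ia] //= i_s; rewrite IHs //; last exact: tux_restr.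
have := i_s; rewrite E' in_setD in_setD1 => /and3P[iS _ iN].
rewrite [N :\ i :\ a]setDDC; have iNa : i \in N :\ a by rewrite !inE ia.
have aNi : a \in N :\ i by rewrite !inE eq_sym ia.
have sSai : S \subset N :\ a :\ i by rewrite subsetD1 sSa.
apply: agree_restr_seq; rewrite ?rem_uniq //.
- by move=> x; rewrite mem_rem_uniq // !inE E' !inE; do !case: (_ == _); case: (_ \in _).
- by apply: tux_restr => //; apply: tux_restr.
- by rewrite setDDC; apply: tux_restr => //; apply: tux_restr.
- by move=> P partP; apply: r_pi; rewrite 1?eq_sym // /emb sSai.
Qed.

Lemma vr_restr N S w i : path_indep r -> i \in N -> S \subset N :\ i -> tux N w ->
  vr r (N :\ i) (r N w i) S = vr r N w S.
Proof.
move=> r_pi iN; rewrite subsetD1 => /andP[sSN iS] tw; rewrite /vr.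
rewrite [RHS](restr_seq_rem (i := i)) ?enum_uniq //; last 2 first.
- exact: mem_enum.
- by rewrite mem_enum inE iS.
(* Both sequences are filters of the same enumeration of [U]. *)
rewrite rem_filter ?enum_uniq // /enum_mem -filter_predI; congr restr_seq.
by apply: eq_filter => x; rewrite /= !inE andbCA.
Qed.

Hypothesis r_null : preserves_null r.

Lemma vr_null N S : S \subset N -> vr r N (@null_game R U) S = 0.
Proof.
rewrite /vr; move: (enum_uniq (N :\: S)) (mem_enum (N :\: S)).
move: (enum (N :\: S)) => s; elim: s N => // a s IHs N us E sSN /=.
have [aN sSa us' E'] := enumerates_behead sSN us E.
rewrite -[RHS](IHs _ us' E' sSa); apply: agree_restr_seq => //.
  by apply: tux_restr.
by move=> P partP; apply: r_null; rewrite // /emb sSa.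
Qed.

Lemma vr_vanish N S w : S \subset N -> tux N w -> agree N S w (@null_game R U) ->
  vr r N w S = 0.
Proof. by move=> sSN tw w0; rewrite (vr_agree sSN tw (@tux_null N) w0) vr_null. Qed.

(** * The potential and the null player property determine [p] *)

Section Potential.
Variable p : rpart R U.
Hypothesis r_pot : forall N w, tux N w -> potr r N w = expect p N w.

(** Localizing [w] at [S] kills every other term on both sides of the equation between the potential
    and the expectation. *)
Lemma potr_coef N S w : S \subset N -> S != set0 -> tux N w ->
  ((#|S|.-1)`! * (#|N| - #|S|)`!)%:R / (#|N|`!)%:R * vr r N w S =
  \sum_(Q | partition Q (N :\: S)) p N (S |: Q) * w S Q.
Proof.
move=> sSN S0 tw; pose w' := localize S xpredT w.
have tw' : tux N w' by exact: tux_localize.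
rewrite (@vr_agree N S w w') //; last by move=> P _; rewrite /w' /localize eqxx.
have := r_pot tw'; rewrite /potr /pot /expect.
under [in RHS]eq_bigr do rewrite mulr_sumr.
rewrite (@sum_part_block _ _ (fun S P => p N P * w' S (P :\ S))).
have SP : (S \subset N) && (S != set0) by rewrite sSN.
rewrite (bigD1 S) //= [in RHS](bigD1 S) //= [X in _ + X]big1 ?[X in _ = _ + X]big1; last first.
- move=> T /andP[/andP[sTN T0] TS]; rewrite vr_vanish ?mulr0 //.
  by move=> P _; rewrite /w' /localize (negbTE TS).
- move=> T /andP[_ TS]; rewrite big1 // => P _.
  by rewrite /w' /localize (negbTE TS) mulr0.
rewrite !addr0 => ->; apply: eq_bigr => P partP.
by rewrite setU1K ?(partition_block_notin S0 partP) // /w' /localize eqxx.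
Qed.

(** A null player has the same zero contributions as in the null game, so monotonicity in both
    directions equates the two payoffs. *)
Lemma good_null_player_property :
  null_player_property (shr r) \/ monotonicity (shr r) -> null_player_property (shr r).
Proof.
case=> // mon N w i iN tw nw.
have <- : shr r N (@null_game R U) i = 0.
  apply: big1 => S; rewrite subsetD1 => /andP[sSN iS].
  by rewrite !vr_null ?subrr ?mulr0 // subUset sub1set iN.
by apply/eqP; rewrite eq_le; apply/andP; split; apply: mon => // S P embP B BP;
  rewrite (nw S P embP B BP) !subrr.
Qed.

Hypothesis r_npp : null_player_property (shr r).

Definition twin_game i T P : game R U := fun S Q =>
  ((S == i |: T) && (Q == P) || (S == T) && (rmv Q i == P))%:R.

(* Player i is null in [twin_game i T P]; this is the null player property
   there, rewritten in terms of p by [potr_coef]. *)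
Lemma p_null_player N i T P : i \in N -> T \subset N :\ i -> T != set0 ->
    partition P (N :\: T :\ i) ->
  (#|N| - #|T|)%:R * p N (i |: T |: P) =
  #|T|%:R * \sum_(B in set0 |: P) p N (T |: addto P i B).
Proof.
move=> iN sTNi T0 partP; have := sTNi; rewrite subsetD1 => /andP[sTN iT].
have iNT : i \in N :\: T by rewrite inE iT.
pose w := twin_game i T P.
have neqT S : i \in S -> (S == T) = false by move=> iS; apply: contraNF iT => /eqP <-.
have neqiT S : i \notin S -> (S == i |: T) = false.
  by move=> iS; apply: contraNF iS => /eqP ->; rewrite setU11.
have eqiT S : i \notin S -> (i |: S == i |: T) = (S == T).
  move=> iS; apply/eqP/eqP => [E|-> //].
  by rewrite -(setU1K iS) E setU1K.
have tw : tux N w.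
  by move=> Q _; rewrite /w /twin_game neqiT ?inE // [set0 == T]eq_sym (negbTE T0).
have nw : null_player N w i.
  move=> S Q; rewrite emb_setD1 // => /and3P[iNS _ partQ] B; rewrite orbC -in_setU1 => BQ.
  have iS : i \notin S by move: iNS; rewrite inE => /andP[].
  rewrite /w /twin_game eqiT // (neqT (i |: S)) ?setU11 // neqiT // (addtoK iNS partQ BQ).
  by rewrite orbF.
(* For [S] other than [T], the game vanishes at [S] and at [i |: S], so the Shapley value reduces to
   one term with a nonzero coefficient. *)
have vE : vr r N w (i |: T) = vr r N w T.
  have := r_npp iN tw nw; rewrite /shr /sh (bigD1 T) //= big1 ?addr0.
    have c0 : (#|T|`! * (#|N| - #|T| - 1)`!)%:R / #|N|`!%:R != 0 :> R.
      by rewrite natrM !mulf_neq0 ?invr_eq0 ?factR_neq0.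
    by move=> /eqP; rewrite mulf_eq0 (negbTE c0) subr_eq0 => /eqP.
  move=> S /andP[]; rewrite subsetD1 => /andP[sSN iS] ST.
  rewrite !vr_vanish ?subrr ?mulr0 // ?subUset ?sub1set ?iN //.
  - by move=> Q _; rewrite /w /twin_game neqiT // (negbTE ST).
  - by move=> Q _; rewrite /w /twin_game eqiT // (negbTE ST) (neqT (i |: S)) ?setU11.
have iT0 : i |: T != set0 by exact: set1U_neq0.
have siT : i |: T \subset N by rewrite subUset sub1set iN.
have ET := potr_coef sTN T0 tw; have := potr_coef siT iT0 tw.
rewrite vE (bigD1 P) /=; last by rewrite setUC -setDDl.
rewrite [X in _ = _ + X -> _]big1; last first.
  move=> Q /andP[_ QP]; rewrite /w /twin_game (negbTE QP) neqT ?setU11 //.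
  by rewrite andbF mulr0.
rewrite {2}/w /twin_game !eqxx mulr1 addr0 => <-.
have -> : \sum_(B in set0 |: P) p N (T |: addto P i B) =
  \sum_(Q | partition Q (N :\: T)) p N (T |: Q) * w T Q.
  rewrite (@sum_addto _ _ (fun Q => p N (T |: Q)) _ _ _ iNT partP) big_mkcondr.
  apply: eq_bigr => Q _; rewrite /w /twin_game neqiT // eqxx /=.
  by case: eqP; rewrite ?mulr1 ?mulr0.
rewrite -ET cardsU1 iT add1n /= !mulrA; congr (_ * _).
(* Both [#|T|] and [#|N| - #|T|] are positive, so each factorial can be unfolded once. *)
have : (#|T| < #|N|)%N by rewrite (cardsD1 i N) iN ltnS subset_leq_card.
rewrite -subn_gt0 -card_gt0 in T0 *; rewrite subnS.
case: (#|N| - #|T|)%N => // k _; case: #|T| T0 => // t _.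
rewrite !factS /= !natrM; ring.
Qed.

(** Apply [p_null_player] to [T] and [P :\ T]: its sum runs over all choices except [T], and adding
    the missing term to both sides completes it. *)
Lemma p_addto_block N P i T : i \in N -> partition P (N :\ i) -> T \in P ->
  #|N|%:R * p N (addto P i T) = #|T|%:R * \sum_(B in set0 |: P) p N (addto P i B).
Proof.
move=> iN partP TP; have T0 := partition_neq0 partP TP.
have sTN := partitionS partP TP.
have partQ := partitionD1 partP TP; rewrite setDDC in partQ.
have := p_null_player iN sTN T0 partQ.
rewrite [X in _ -> _ = _ * X](bigD1 T) /=; last by rewrite !inE TP orbT.
have -> : addto P i T = i |: T |: P :\ T by rewrite /addto (negbTE T0) setUC [T :|: _]setUC setUC.
have -> : \sum_(B in set0 |: P :\ T) p N (T |: addto (P :\ T) i B) =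
  \sum_(B in set0 |: P | B != T) p N (addto P i B).
  apply: eq_big => [B|B].
    by rewrite !inE; case: (eqVneq B T) => [->|]; rewrite ?andbF ?andbT ?orbF // (negbTE T0).
  rewrite !inE => /orP[/eqP ->|/andP[BT BP]]; congr (p N _).
    by rewrite /addto eqxx setUCA setD1K.
  rewrite /addto (negbTE (partition_neq0 partP BP)) setUCA; congr (_ |: _).
  by apply/setP=> C; rewrite !inE; case: eqVneq => // ->; rewrite TP eq_sym BT.
rewrite natrB ?subset_leq_card ?(subset_trans sTN) ?subsetDl // => E.
by rewrite mulrDr -E mulrBl addrC subrK.
Qed.

(** Blocks are covered by [p_addto_block]; the new block receives what remains, since the weights
    add up to [#|N|]. *)
Lemma p_addto N P i B : i \in N -> partition P (N :\ i) -> B \in set0 |: P ->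
  #|N|%:R * p N (addto P i B) = (weight B)%:R * \sum_(B in set0 |: P) p N (addto P i B).
Proof.
move=> iN partP; have P0 := partition0 partP.
have wE T : T \in P -> weight T = #|T|.
  by move=> TP; apply/maxn_idPr; rewrite card_gt0 (partition_neq0 partP TP).
rewrite in_setU1 => /orP[/eqP ->|BP]; last by rewrite (p_addto_block iN partP BP) wE.
set F := \sum_(B in _) _.
have sumT : \sum_(T in P) #|N|%:R * p N (addto P i T) = (\sum_(T in P) weight T)%:R * F.
  rewrite natr_sum mulr_suml; apply: eq_bigr => T TP.
  by rewrite (p_addto_block iN partP TP) wE.
have : #|N|%:R * F = (weight (set0 : {set U}) + \sum_(T in P) weight T)%:R * F.
  by rewrite -(sum_weight iN partP) big_setU1 ?P0.
by rewrite {1}/F big_setU1 ?P0 //= mulrDr mulr_sumr sumT natrD mulrDl => /addIr.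
Qed.

(** On a fibre of [rmv], both [p] and [ewens] are proportional to [weight], which cancels in the
    ratio. *)
Lemma p_ewens_rmv N P Q i : i \in N -> partition P N -> partition Q N ->
  rmv P i = rmv Q i -> p N P / ewens N P = p N Q / ewens N Q.
Proof.
move=> iN partP partQ PQ.
suff E P' : partition P' N -> p N P' / ewens N P' =
    \sum_(B in set0 |: rmv P' i) p N (addto (rmv P' i) i B) / ewens (N :\ i) (rmv P' i).
  by rewrite !E // PQ.
move=> partP'; have /andP[BP /eqP P'E] := rmvK iN partP'.
have part' := partition_rmv iN partP'.
have := p_addto iN part' BP; have := ewens_addto R iN part' BP; rewrite P'E => -> E.
have N0 : #|N|%:R != 0 :> R by rewrite pnatr_eq0 (cardsD1 i) iN.
have W0 : (weight (pblock P' i :\ i))%:R != 0 :> R.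
  by rewrite pnatr_eq0 -lt0n leq_max.
rewrite -mulr_suml; apply: (mulfI W0); rewrite [RHS]mulrA -E.
have e0 := ewens_neq0 R part'.
by field; rewrite N0 e0 W0.
Qed.

Definition discrete N : {set {set U}} := [set [set x] | x in N].

(* Isolating a player [x] keeps the ratio, and turns [P] into the discrete
   partition after finitely many steps. *)
Lemma p_ewens_const N P : partition P N ->
  p N P / ewens N P = p N (discrete N) / ewens N (discrete N).
Proof.
(* Induction on the number of players that are not isolated. *)
have [n] := ubnP #|[set x in N | [set x] \notin P]|.
elim: n P => // n IHn P; rewrite ltnS => leP partP.
have [E|[x]] := set_0Vmem [set x in N | [set x] \notin P].
  have sP x : x \in N -> [set x] \in P.
    by move=> xN; move/setP/(_ x): E; rewrite !inE xN => /negbFE.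
  suff -> : P = discrete N by [].
  apply/setP=> B; apply/idP/imsetP=> [BP|[x /sP xP -> //]].
  have [x xB] := set0Pn _ (partition_neq0 partP BP).
  have xN := subsetP (partitionS partP BP) _ xB.
  exists x => //; have tP := partition_trivIset partP.
  by rewrite -(def_pblock tP BP xB) (def_pblock tP (sP _ xN)) ?inE.
rewrite inE => /andP[xN xP]; have partR := partition_rmv xN partP.
have Q0 : set0 \in set0 |: rmv P x by rewrite setU11.
have partQ := partition_addto xN partR Q0.
rewrite (p_ewens_rmv xN partP partQ) ?(addtoK xN partR Q0) // IHn //.
(* Singleton blocks survive the isolation of [x], and [x] itself leaves the set, so the count drops
   strictly. *)
apply: leq_trans leP; apply/proper_card/properP; split.
  apply/subsetP=> y; rewrite !inE => /andP[-> /=]; apply: contra => yP.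
  rewrite /addto eqxx !inE; case: (eqVneq y x) => [-> |yx]; first by rewrite eqxx.
  apply/orP; right; apply/andP; split.
    by apply/set0Pn; exists y; rewrite inE.
  apply/imsetP; exists [set y] => //; apply/setP=> u; rewrite !inE.
  by case: (eqVneq u y) => [->|]; rewrite ?yx ?andbF.
by exists x; rewrite !inE xN //= /addto eqxx setU11.
Qed.

(** The constant ratio is 1 because both distributions have total mass 1. *)
Lemma p_unique : random_partition p -> forall N P, p N P = ewens N P.
Proof.
case=> _ p_out p_sum N P.
have [partP|partP] := boolP (is_part P N); last by rewrite p_out // /ewens (negbTE partP).
set c := p N (discrete N) / ewens N (discrete N).
have pE Q : partition Q N -> p N Q = c * ewens N Q.
  by move=> partQ; rewrite /c -(p_ewens_const partQ) divfK // ewens_neq0.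
have := p_sum N; rewrite (eq_bigr _ pE) -mulr_sumr sum_ewens mulr1 => c1.
by rewrite pE // c1 mul1r.
Qed.

End Potential.

(** * The Ewens potential determines the restriction operator *)

Lemma vr_mean N S w : (forall N w, tux N w -> potr r N w = expect ewens N w) ->
  S \subset N -> S != set0 -> tux N w -> vr r N w S = mean N w S.
Proof.
move=> r_pot sSN S0 tw.
have c0 : ((#|S|.-1)`! * (#|N| - #|S|)`!)%:R / (#|N|`!)%:R != 0 :> R.
  by rewrite natrM !mulf_neq0 ?invr_eq0 ?factR_neq0.
(* In [potr_coef] for the Ewens distribution, [ewens_setU1] produces the same coefficient on the
   right, and it cancels. *)
apply: (mulfI c0); rewrite (potr_coef r_pot) // /mean mulr_sumr.
by apply: eq_bigr => P partP; rewrite ewens_setU1 // mulrA.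
Qed.

End RestrictionOperator.

Lemma rstar_unique (r : restr_op R U) N w i : good_op ewens r -> i \in N -> tux N w ->
  eqg (N :\ i) (r N w i) (rstar N w i).
Proof.
case=> r_op r_pi r_null r_pot _ iN tw S P embP.
have := embP; rewrite emb_setD1 // => /and3P[iNS sSN partP].
(* The potential says nothing about the empty coalition; there both games are 0 because they are TUX
   games. *)
have [S0|S0] := eqVneq S set0.
  move: partP; rewrite S0 setD0 => partP.
  by rewrite (tux_restr r_op iN tw) // ((rstar_restriction_op R U).1 _ _ _ iN tw).
have sSNi : S \subset N :\ i by move: embP => /andP[].
(* With [w'] supported on the fibre over [P], locality and preservation of null games make the
   restricted game vanish at [S] except at [P], so its mean is a single term. *)
pose w' := localize S (fun Q => rmv Q i == P) w.
have tw' : tux N w' by exact: tux_localize.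
have := vr_restr r_op r_pi iN sSNi tw'.
have tr : tux (N :\ i) (r N w' i) by exact: tux_restr.
rewrite !(vr_mean r_op r_null r_pot) // /mean setDDC.
rewrite (bigD1 P) //= big1 ?addr0; last first.
  move=> Q /andP[partQ QP]; have embQ : emb (N :\ i) S Q by rewrite emb_setD1 // iNS sSN.
  rewrite (restr_local r_op iN tw' (@tux_null N) embQ) ?r_null ?mulr0 //.
  by move=> Q' _ rQ; rewrite /w' /localize rQ (negbTE QP) andbF.
rewrite (restr_local r_op iN tw' tw embP); last first.
  by move=> Q _ rQ; rewrite /w' /localize rQ !eqxx.
move=> E; apply: (mulfI (ewens_neq0 R partP)); rewrite ewens_rstar // E [RHS]big_mkcondr.
by apply: eq_bigr => Q _; rewrite /w' /localize eqxx /=; case: ifP; rewrite ?mulr0.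
Qed.

End Uniqueness.

Theorem theorem5 (R : realType) (U : finType) :
  (* the Ewens distribution is a random partition with properties (i), (ii) *)
  random_partition (@ewens R U) /\
  generates_potential (@ewens R U) /\
  (exists r : restr_op R U, good_op ewens r) /\
  (* uniqueness of the random partition *)
  (forall p : rpart R U, random_partition p -> generates_potential p ->
     (exists r : restr_op R U, good_op p r) ->
     forall (N : {set U}) (P : {set {set U}}), p N P = ewens N P) /\
  (* r^star is such a restriction operator, and the unique one *)
  good_op ewens (@rstar R U) /\
  (forall r : restr_op R U, good_op ewens r ->
     forall (N : {set U}) (w : game R U) (i : U), i \in N -> tux N w -> eqg (N :\ i) (r N w i) (rstar N w i)) /\
  (* Sh^{r*} = MPW *)
  (forall (N : {set U}) (w : game R U) (i : U), i \in N -> tux N w -> shr rstar N w i = mpw N w i).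
Proof.
split; first exact: ewens_random_partition.
split; first exact: ewens_generates_potential.
split; first by exists rstar; exact: rstar_good.
split; last by split; [exact: rstar_good | split => *; [exact: rstar_unique | exact: shr_rstar]].
move=> p p_part _ [r [r_op _ r_null r_pot r_npp]].
by apply: (p_unique r_op r_null r_pot) p_part; apply: good_null_player_property.
Qed.
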